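(* For every set $\Gamma\cup\{\phi\}$ of $\mathcal{L}^+$-sentences: $\Gamma\vdash\phi$ if and only if $\Gamma\vdash_{\mathsf{TJK}^{d+}}\phi$. That is, $\phi$ is derivable from $\Gamma$ in the natural deduction system $\mathcal{N}\mathsf{BQL}_{\mathsf{CD}}^r$ iff $\phi$ is derivable from $\Gamma$ in the original axiomatization of $\mathsf{TJK}^{d+}$.
   Context: Language. $\mathcal{L}$ is an arbitrary first-order language with primitive operators $\top,\bot,\wedge,\vee,\rightarrow,\forall,\exists$ (identity, if present, is a non-logical relation symbol), and $\mathcal{L}^+=\mathcal{L}\cup\{a_i:i\in\omega\}$ with each $a_i$ a fresh constant symbol. $\phi(t)$ is the result of substituting the closed term $t$ for the variable $v$ in $\phi$. In both systems a proof is a finite tree of (possibly discharged) $\mathcal{L}^+$-sentences; leaves are open assumptions unless discharged, and axioms are leaves that count as discharged. ''$\Gamma$ derives $\phi$'' means there is a proof with root $\phi$ all of whose open assumptions are in $\Gamma$. Common restrictions. (C1) Only sentences occur in proofs (so, e.g., $\phi$ has no free variables in CD). (C2) In $\forall$-Int, $a_i$ may not occur in $\phi$ or in any open assumption of the subproof of $\phi(a_i)$. (C3) In $\exists$-Elim, $a_i$ may not occur in $\phi$, in $\psi$, or in any open assumption other than $\phi(a_i)$ of the subproof of $\psi$. (C4) In $\exists$-Elim all open occurrences of $\phi(a_i)$ in the subproof of $\psi$ must be discharged; in the other discharging rules any number (including zero) of open occurrences of the indicated assumption may be discharged. Common rules. $\top$-Int: $\top$ is an axiom. $\bot$-Elim: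 from $\bot$ infer $\phi$. $\wedge$-Int: from $\phi$ and $\psi$ infer $\phi\wedge\psi$. $\wedge$-Elim: from $\phi\wedge\psi$ infer $\phi$; likewise $\psi$. $\vee$-Int: from $\phi$ infer $\phi\vee\psi$; likewise from $\psi$. $\vee$-Elim: from $\phi\vee\psi$, a subproof of $\chi$ (discharging $\phi$) and a subproof of $\chi$ (discharging $\psi$), infer $\chi$. $\rightarrow$-Elim: from $\phi$ (left premise) and $\phi\rightarrow\psi$ (right premise) infer $\psi$. $\forall$-Int: from $\phi(a_i)$ infer $\forall v\phi$. $\forall$-Elim: from $\forall v\phi$ infer $\phi(t)$. CD: from $\forall v(\phi\vee\psi)$ infer $\phi\vee\forall v\psi$. $\exists$-Int: from $\phi(t)$ infer $\exists v\phi$. $\exists$-Elim: from $\exists v\phi$ and a subproof of $\psi$ (discharging $\phi(a_i)$) infer $\psi$. The system $\mathcal{N}\mathsf{BQL}_{\mathsf{CD}}^r$ (with derivability $\vdash$) has the common rules together with: $\rightarrow$-Int: from a subproof of $\psi$ (discharging $\phi$) infer $\phi\rightarrow\psi$. Internal Transitivity: from $\phi\rightarrow\psi$ and $\psi\rightarrow\chi$ infer $\phi\rightarrow\chi$. Internal $\wedge$-Int: from $\phi\rightarrow\psi$ and $\phi\rightarrow\chi$ infer $\phi\rightarrow\psi\wedge\chi$. Internal $\vee$-Elim: from $\phi\rightarrow\chi$ and $\psi\rightarrow\chi$ infer $\phi\vee\psi\rightarrow\chi$. Internal $\forall$-Int: from $\forall v(\phi\rightarrow\psi)$ infer $\phi\rightarrow\forall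 v\psi$. Internal $\exists$-Elim: from $\forall v(\phi\rightarrow\psi)$ infer $\exists v\phi\rightarrow\psi$. Proofs satisfy (C1)–(C4) and (C5): no unsafe occurrence of an open assumption may be discharged. An occurrence of a (possibly discharged) assumption at a leaf is unsafe in a proof if it lies in the subtree ending in the right premise $\alpha\rightarrow\beta$ of some application of $\rightarrow$-Elim (including the case where the leaf is that premise itself). The original axiomatization of $\mathsf{TJK}^{d+}$ (with derivability $\vdash_{\mathsf{TJK}^{d+}}$) has the common rules with restrictions (C1)–(C4) only, together with the rule: from $\phi\rightarrow\psi$ and $\chi\rightarrow\gamma$ infer $(\psi\rightarrow\chi)\rightarrow(\phi\rightarrow\gamma)$; and the axioms: $\phi\rightarrow\phi$; $\phi\rightarrow\top$; $\bot\rightarrow\phi$; $(\chi\rightarrow\phi)\wedge(\chi\rightarrow\psi)\rightarrow(\chi\rightarrow\phi\wedge\psi)$; $\phi\wedge\psi\rightarrow\phi$; $\phi\wedge\psi\rightarrow\psi$; $\phi\rightarrow\phi\vee\psi$; $\psi\rightarrow\phi\vee\psi$; $(\phi\rightarrow\chi)\wedge(\psi\rightarrow\chi)\rightarrow(\phi\vee\psi\rightarrow\chi)$; $\phi\wedge(\psi\vee\chi)\rightarrow(\phi\wedge\psi)\vee(\phi\wedge\chi)$; $\forall v(\phi\rightarrow\psi)\rightarrow(\phi\rightarrow\forall v\psi)$; $\forall v\phi\rightarrow\phi(t)$; $\phi(t)\rightarrow\exists v\phi$; $\forall v(\phi\rightarrow\psi)\rightarrow(\exists v\phi\rightarrow\psi)$;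 $\forall v(\phi\vee\psi)\rightarrow\phi\vee\forall v\psi$; $\phi\wedge\exists v\psi\rightarrow\exists v(\phi\wedge\psi)$; $(\phi\rightarrow\psi)\wedge(\psi\rightarrow\chi)\rightarrow(\phi\rightarrow\chi)$; $(\phi\rightarrow\psi)\rightarrow((\psi\rightarrow\chi)\rightarrow(\phi\rightarrow\chi))$; $(\phi\rightarrow\psi)\rightarrow((\chi\rightarrow\phi)\rightarrow(\chi\rightarrow\psi))$; $\phi\rightarrow(\psi\rightarrow\phi)$. *)

(* Defs.v *)
From mathcomp Require Import all_boot.
From Stdlib Require List.

Set Implicit Arguments.
Unset Strict Implicit.
Unset Printing Implicit Defensive.

(** Constant symbols are the function symbols of arity 0; identity, if present,
    is just one of the relation symbols. *)
Record signature := Signature {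
  fun_sym : Type;
  fun_arity : fun_sym -> nat;
  rel_sym : Type;
  rel_arity : rel_sym -> nat
}.

Section Syntax.
Variable L : signature.

(** Terms and formulas are those of [L] expanded with the fresh constants
    [Par i], i.e. a_i. *)
Inductive term :=
  | Var of nat
  | Par of nat
  | Fun (f : fun_sym L) of {ffun 'I_(fun_arity f) -> term}.

Inductive form :=
  | Top
  | Bot
  | Rel (r : rel_sym L) of {ffun 'I_(rel_arity r) -> term}
  | And of form & form
  | Or of form & form
  | Imp of form & form
  | All of nat & form
  | Ex of nat & form.

Fixpoint var_in_term (v : nat) (t : term) : bool :=
  match t with
  | Var w => v == w
  | Par _ => false
  | Fun _ ts => [exists k, var_in_term v (ts k)]
  end.

Fixpoint free_in (v : nat) (A : form) : bool :=
  match A with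
  | Top | Bot => false
  | Rel _ ts => [exists k, var_in_term v (ts k)]
  | And A B | Or A B | Imp A B => free_in v A || free_in v B
  | All w A | Ex w A => (v != w) && free_in v A
  end.

Definition closed (t : term) : Prop := forall v, ~~ var_in_term v t.
Definition sentence (A : form) : Prop := forall v, ~~ free_in v A.

Fixpoint par_in_term (i : nat) (t : term) : bool :=
  match t with
  | Var _ => false
  | Par j => i == j
  | Fun _ ts => [exists k, par_in_term i (ts k)]
  end.

Fixpoint par_in (i : nat) (A : form) : bool :=
  match A with
  | Top | Bot => false
  | Rel _ ts => [exists k, par_in_term i (ts k)]
  | And A B | Or A B | Imp A B => par_in i A || par_in i B
  | All _ A | Ex _ A => par_in i A
  end.

Fixpoint subst_term (v : nat) (t s : term) : term :=
  match s with
  | Var w => if w == v then t else s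
  | Par _ => s
  | Fun f ss => Fun [ffun k => subst_term v t (ss k)]
  end.

(** Replaces the free occurrences of [v] by [t]; nothing is renamed, as [t] is
    always closed where this is used. *)
Fixpoint subst (v : nat) (t : term) (A : form) : form :=
  match A with
  | Top => Top
  | Bot => Bot
  | Rel r ss => Rel [ffun k => subst_term v t (ss k)]
  | And A B => And (subst v t A) (subst v t B)
  | Or A B => Or (subst v t A) (subst v t B)
  | Imp A B => Imp (subst v t A) (subst v t B)
  | All w A => All w (if w == v then A else subst v t A)
  | Ex w A => Ex w (if w == v then A else subst v t A)
  end.

End Syntax.

Arguments Var {L}.
Arguments Par {L}.
Arguments Top {L}.
Arguments Bot {L}.

Declare Scope fo_scope.
Delimit Scope fo_scope with fo.
Bind Scope fo_scope with form.
Notation "A :/\: B" := (And A B) (at level 51, right associativity) : fo_scope.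
Notation "A :\/: B" := (Or A B) (at level 53, right associativity) : fo_scope.
Notation "A ~> B" := (Imp A B) (at level 55, right associativity) : fo_scope.
Local Open Scope fo_scope.

Inductive system := NBQLCDr | TJKdplus.

Section Proofs.
Variables (L : signature) (S : system).
Implicit Types (A B C D : form L) (v i : nat) (t : term L).

Inductive axiom : form L -> Prop :=
  | ax_top : axiom Top
  | ax_id A : S = TJKdplus -> axiom (A ~> A)
  | ax_to_top A : S = TJKdplus -> axiom (A ~> Top)
  | ax_from_bot A : S = TJKdplus -> axiom (Bot ~> A)
  | ax_and_intro A B C : S = TJKdplus ->
      axiom ((C ~> A) :/\: (C ~> B) ~> (C ~> A :/\: B))
  | ax_and_l A B : S = TJKdplus -> axiom (A :/\: B ~> A)
  | ax_and_r A B : S = TJKdplus -> axiom (A :/\: B ~> B)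
  | ax_or_l A B : S = TJKdplus -> axiom (A ~> A :\/: B)
  | ax_or_r A B : S = TJKdplus -> axiom (B ~> A :\/: B)
  | ax_or_elim A B C : S = TJKdplus ->
      axiom ((A ~> C) :/\: (B ~> C) ~> (A :\/: B ~> C))
  | ax_distr A B C : S = TJKdplus ->
      axiom (A :/\: (B :\/: C) ~> (A :/\: B) :\/: (A :/\: C))
  | ax_all_intro v A B : S = TJKdplus ->
      axiom (All v (A ~> B) ~> (A ~> All v B))
  | ax_all_elim v A t : S = TJKdplus -> closed t ->
      axiom (All v A ~> subst v t A)
  | ax_ex_intro v A t : S = TJKdplus -> closed t ->
      axiom (subst v t A ~> Ex v A)
  | ax_ex_elim v A B : S = TJKdplus ->
      axiom (All v (A ~> B) ~> (Ex v A ~> B))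
  | ax_cd v A B : S = TJKdplus ->
      axiom (All v (A :\/: B) ~> A :\/: All v B)
  | ax_ex_distr v A B : S = TJKdplus ->
      axiom (A :/\: Ex v B ~> Ex v (A :/\: B))
  | ax_trans A B C : S = TJKdplus ->
      axiom ((A ~> B) :/\: (B ~> C) ~> (A ~> C))
  | ax_suffix A B C : S = TJKdplus ->
      axiom ((A ~> B) ~> ((B ~> C) ~> (A ~> C)))
  | ax_prefix A B C : S = TJKdplus ->
      axiom ((A ~> B) ~> ((C ~> A) ~> (C ~> B)))
  | ax_weak A B : S = TJKdplus -> axiom (A ~> (B ~> A)).

Inductive rule1 : form L -> form L -> Prop :=
  | bot_elim A : rule1 Bot A
  | and_elim_l A B : rule1 (A :/\: B) A
  | and_elim_r A B : rule1 (A :/\: B) B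
  | or_intro_l A B : rule1 A (A :\/: B)
  | or_intro_r A B : rule1 B (A :\/: B)
  | all_elim v A t : closed t -> rule1 (All v A) (subst v t A)
  | cd v A B : rule1 (All v (A :\/: B)) (A :\/: All v B)
  | ex_intro v A t : closed t -> rule1 (subst v t A) (Ex v A)
  | internal_all_intro v A B : S = NBQLCDr ->
      rule1 (All v (A ~> B)) (A ~> All v B)
  | internal_ex_elim v A B : S = NBQLCDr ->
      rule1 (All v (A ~> B)) (Ex v A ~> B).

Inductive rule2 : form L -> form L -> form L -> Prop :=
  | and_intro A B : rule2 A B (A :/\: B)
  | internal_trans A B C : S = NBQLCDr -> rule2 (A ~> B) (B ~> C) (A ~> C)
  | internal_and_intro A B C : S = NBQLCDr ->
      rule2 (A ~> B) (A ~> C) (A ~> B :/\: C)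
  | internal_or_elim A B C : S = NBQLCDr ->
      rule2 (A ~> C) (B ~> C) (A :\/: B ~> C)
  | affixing A B C D : S = TJKdplus ->
      rule2 (A ~> B) (C ~> D) ((B ~> C) ~> (A ~> D)).

(** An occurrence of an open assumption at a leaf; the flag tells whether it is
    unsafe, i.e. lies in the subtree ending in the right premise of some
    [Imp_elim], or is that premise itself. *)
Definition occurrence : Type := form L * bool.

Definition make_unsafe (O : seq occurrence) : seq occurrence :=
  [seq (o.1, true) | o <- O].

(** [discharge A O O']: [O'] is what is left of [O] once any number of
    occurrences of [A] have been discharged; in [NBQLCDr] the discharged
    occurrences have to be safe. *)
Inductive discharge A : seq occurrence -> seq occurrence -> Prop :=
  | discharge_nil : discharge A [::] [::]
  | discharge_keep o O O' :
      discharge A O O' -> discharge A (o :: O) (o :: O')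
  | discharge_drop u O O' : (S = NBQLCDr -> u = false) ->
      discharge A O O' -> discharge A ((A, u) :: O) O'.

(** [proof O A] is the type of proof trees with root [A] whose open leaves,
    from left to right, are [O]. Safety of a discharged leaf is judged in the
    subproof at whose root the discharge takes place: leaves already discharged
    are no longer in [O] when [make_unsafe] is applied. *)
Inductive proof : seq occurrence -> form L -> Type :=
  | Assumption A : sentence A -> proof [:: (A, false)] A
  | Axiom_leaf A : axiom A -> sentence A -> proof [::] A
  | Rule1 O A B : rule1 A B -> sentence B -> proof O A -> proof O B
  | Rule2 O1 O2 A B C : rule2 A B C -> sentence C ->
      proof O1 A -> proof O2 B -> proof (O1 ++ O2) C
  | Imp_elim O1 O2 A B : sentence B ->
      proof O1 A -> proof O2 (A ~> B) -> proof (O1 ++ make_unsafe O2) B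
  | Imp_intro O O' A B : S = NBQLCDr -> sentence (A ~> B) ->
      proof O B -> discharge A O O' -> proof O' (A ~> B)
  | Or_elim O O1 O1' O2 O2' A B C : sentence C ->
      proof O (A :\/: B) ->
      proof O1 C -> discharge A O1 O1' ->
      proof O2 C -> discharge B O2 O2' ->
      proof (O ++ O1' ++ O2') C
  | All_intro O v i A : sentence (All v A) ->
      proof O (subst v (Par i) A) ->
      ~~ par_in i A ->
      (forall o, List.In o O -> ~~ par_in i o.1) ->
      proof O (All v A)
  | Ex_elim O O1 O1' v i A B : sentence B ->
      proof O (Ex v A) ->
      proof O1 B -> discharge (subst v (Par i) A) O1 O1' ->
      (forall o, List.In o O1' -> o.1 <> subst v (Par i) A) ->
      ~~ par_in i A -> ~~ par_in i B ->
      (forall o, List.In o O1 -> o.1 <> subst v (Par i) A ->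
         ~~ par_in i o.1) ->
      proof (O ++ O1') B.

Definition derives (Gamma : form L -> Prop) A : Prop :=
  exists (O : seq occurrence) (_ : proof O A),
    forall o, List.In o O -> Gamma o.1.

End Proofs.

Arguments derives {L}.

(* Main.v *)
(* From natural deduction to the axiomatization: the undischarged safe assumptions
   of a subproof are internalized. If [S] is a selection of the safe open
   occurrences of a proof of [A] and [G] consists of the remaining ones, then [G]
   derives [conj S ~> A]; [Imp_intro] then amounts to currying, which weakening
   allows. The right premise of [Imp_elim] has only unsafe occurrences, so there
   [S] is empty and the implication itself is derivable from [G].

   Conversely, the axiomatization discharges unsafe assumptions in [Or_elim] and
   [Ex_elim]. This is avoided by never using [Imp_elim]: with [box A := Top ~> A],
   a proof of [A] is turned into one of [box (... (box A))] all of whose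
   assumptions are safe. Modus ponens becomes Internal Transitivity, at the price
   of more boxes, and the two eliminations become [Imp_intro] followed by their
   internal forms. The boxes are stripped off at the very end, where nothing
   remains to be discharged. *)

From mathcomp Require Import all_boot.
From Stdlib Require List.
From Stdlib Require Import Classical.
Require Import Defs.

Set Implicit Arguments.
Unset Strict Implicit.
Unset Printing Implicit Defensive.

Local Open Scope fo_scope.

(** * Substitution, sentences and fresh parameters *)

Section Syntax.
Variable L : signature.
Implicit Types (A B C D : form L) (s t : term L).

(** The arguments of [Fun] sit inside a finite function, so the induction hypothesis for them has to
    be set up by hand. *)
Lemma term_nested_ind (P : term L -> Prop) :
  (forall v, P (Var v)) -> (forall i, P (Par i)) ->
  (forall f (ss : {ffun 'I_(fun_arity f) -> term L}),
     (forall k, P (ss k)) -> P (Fun ss)) ->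
  forall s, P s.
Proof.
move=> HV HP HF; fix IH 1; case=> [v|i|f ss].
- exact: HV.
- exact: HP.
- by apply: HF => k; apply: IH.
Qed.

Lemma subst_term_notin v t s : ~~ var_in_term v s -> subst_term v t s = s.
Proof.
elim/term_nested_ind: s => [w|i|f ss IH] //=.
  by rewrite eq_sym => /negbTE ->.
rewrite negb_exists => /forallP nv; congr Fun.
by apply/ffunP => k; rewrite ffunE IH.
Qed.

Lemma var_in_subst_term w v t s : closed t ->
  var_in_term w (subst_term v t s) = (w != v) && var_in_term w s.
Proof.
move=> ct; elim/term_nested_ind: s => [x|i|f ss IH] /=.
- case: (x =P v) => [->|/eqP xv] /=.
    by rewrite (negbTE (ct w)) andNb.
  by case: (w =P x) => [->|_]; rewrite ?xv ?andbF.
- by rewrite andbF.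
- under eq_existsb => k do rewrite ffunE IH.
  by case: (w != v) => //=; apply/existsP => -[].
Qed.

Lemma subst_notin v t A : ~~ free_in v A -> subst v t A = A.
Proof.
elim: A => //= [r ss|A IA B IB|A IA B IB|A IA B IB|w A IA|w A IA].
- rewrite negb_exists => /forallP nv; congr Rel.
  by apply/ffunP => k; rewrite ffunE subst_term_notin.
- by rewrite negb_or => /andP[/IA -> /IB ->].
- by rewrite negb_or => /andP[/IA -> /IB ->].
- by rewrite negb_or => /andP[/IA -> /IB ->].
- by rewrite [w == v]eq_sym; case: eqP => //= _ /IA ->.
- by rewrite [w == v]eq_sym; case: eqP => //= _ /IA ->.
Qed.

Lemma free_in_subst w v t A : closed t ->
  free_in w (subst v t A) = (w != v) && free_in w A.
Proof.
move=> ct; elim: A => /= [||r ss|A IA B IB|A IA B IB|A IA B IB|x A IA|x A IA];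
  rewrite ?andbF ?IA ?IB ?andb_orr //.
- under eq_existsb => k do rewrite ffunE var_in_subst_term //.
  by case: (w != v) => //=; apply/existsP => -[].
- by case: (x =P v) => [->|_]; rewrite ?IA; case: (w != v); rewrite ?andbF.
- by case: (x =P v) => [->|_]; rewrite ?IA; case: (w != v); rewrite ?andbF.
Qed.

Lemma closed_Par i : closed (Par i : term L).
Proof. by []. Qed.

Lemma sentence_subst v t A : closed t ->
  sentence (subst v t A) <-> sentence (All v A).
Proof.
by move=> ct; split=> sA w; have := sA w; rewrite /= free_in_subst.
Qed.

(** A bound, rather than a single fresh index, lets finitely many subterms be combined by taking a
    maximum. *)
Lemma term_fresh s : exists n, forall i, n <= i -> ~~ par_in_term i s.
Proof.
elim/term_nested_ind: s => [v|j|f ss IH].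
- by exists 0.
- by exists j.+1 => i /= lt_ji; rewrite gtn_eqF.
- have [g Hg] := fin_all_exists IH.
  exists (\max_k g k) => i le_i /=; rewrite negb_exists; apply/forallP => k.
  by apply: Hg; apply: leq_trans le_i; apply: leq_bigmax.
Qed.

Lemma form_fresh A : exists n, forall i, n <= i -> ~~ par_in i A.
Proof.
have two A' B' : (exists n, forall i, n <= i -> ~~ par_in i A') ->
    (exists n, forall i, n <= i -> ~~ par_in i B') ->
    exists n, forall i, n <= i -> ~~ (par_in i A' || par_in i B').
  move=> [n Hn] [m Hm]; exists (maxn n m) => i.
  by rewrite geq_max negb_or => /andP[/Hn -> /Hm ->].
elim: A => [||r ss|A IA B IB|A IA B IB|A IA B IB|v A IA|v A IA] //=;
  try by [exists 0 | apply: two].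
have [g Hg] := fin_all_exists (fun k => term_fresh (ss k)).
exists (\max_k g k) => i le_i; rewrite negb_exists; apply/forallP => k.
by apply: Hg; apply: leq_trans le_i; apply: leq_bigmax.
Qed.

Lemma sentence_And A B : sentence (A :/\: B) <-> sentence A /\ sentence B.
Proof.
split=> [sAB|[sA sB] v]; last by rewrite /= negb_or sA sB.
by split=> v; have := sAB v; rewrite /= negb_or => /andP[].
Qed.

Lemma sentence_Or A B : sentence (A :\/: B) <-> sentence A /\ sentence B.
Proof. exact: sentence_And. Qed.

Lemma sentence_Imp A B : sentence (A ~> B) <-> sentence A /\ sentence B.
Proof. exact: sentence_And. Qed.

End Syntax.

(** Being a sentence is checked one variable at a time, which leaves a Boolean case analysis. *)
Ltac sent :=
  let w := fresh "w" in
  rewrite /sentence; move=> w;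
  repeat match goal with H : sentence _ |- _ => move: (H w); clear H end;
  rewrite /=;
  repeat match goal with |- context [w == ?v] => case: (w == v) => //= end;
  repeat match goal with |- context [free_in w ?A] => case: (free_in w A) => //= end.

Lemma In_cat T (x : T) s1 s2 :
  List.In x (s1 ++ s2) <-> List.In x s1 \/ List.In x s2.
Proof. by elim: s1 => /= [|y s1 ->]; tauto. Qed.

Lemma In_make_unsafe L (O : seq (occurrence L)) o :
  List.In o (make_unsafe O) -> exists2 o', List.In o' O & o = (o'.1, true).
Proof.
elim: O => //= o1 O IH [<-|/IH[o' ? ?]]; first by exists o1; auto.
by exists o'; auto.
Qed.

(** * Derivability relative to a set of occurrences *)

Section Derivability.
Variables (L : signature) (S : system).
Implicit Types (A B C D : form L) (U : occurrence L -> Prop).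

(** The condition is on occurrences, so that it covers both [derives], which ignores the flag, and
    derivability from safe assumptions only. *)
Definition entails U A : Prop :=
  exists (O : seq (occurrence L)) (_ : proof S O A),
    forall o, List.In o O -> U o.

Lemma discharge_sub A (O O' : seq (occurrence L)) o :
  discharge S A O O' -> List.In o O' -> List.In o O.
Proof.
by elim=> //= [o' P P' _ IH [->|/IH]|u P P' _ _ IH /IH]; auto.
Qed.

Lemma discharge_in A (O O' : seq (occurrence L)) o :
  discharge S A O O' -> List.In o O -> o.1 = A \/ List.In o O'.
Proof.
by elim=> //= [o' P P' _ IH [->|/IH[]]|u P P' _ _ IH [<-|/IH]]; auto.
Qed.

(** Drop exactly the occurrences not known to satisfy [U]: they are safe copies of [A], hence
    dischargeable in either system. *)
Lemma discharge_exists A U (O : seq (occurrence L)) :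
  (forall o, List.In o O -> U o \/ o = (A, false)) ->
  exists O', discharge S A O O' /\ forall o, List.In o O' -> U o.
Proof.
elim: O => [_|o O IH H]; first by exists [::]; split=> //; constructor.
have [|O' [dO' HO']] := IH; first by move=> o' /or_intror /H.
have [Uo|->] := H o (or_introl erefl).
  by exists (o :: O'); split=> [|o' [<-|/HO']] //; constructor.
by exists O'; split=> //; constructor.
Qed.

Lemma proof_sentence (O : seq (occurrence L)) A : proof S O A -> sentence A.
Proof. by case. Qed.

Lemma proof_open_sentence (O : seq (occurrence L)) A : proof S O A ->
  forall o, List.In o O -> sentence o.1.
Proof.
elim=> {O A}.
- by move=> A sA o [<-|[]].
- by [].
- by [].
- by move=> O1 O2 A B C _ _ _ IH1 _ IH2 o /In_cat[/IH1|/IH2].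
- move=> O1 O2 A B _ _ IH1 _ IH2 o /In_cat[/IH1//|].
  by move=> /In_make_unsafe[o' /IH2 ? ->].
- by move=> O O' A B _ _ _ IH d o /(discharge_sub d)/IH.
- move=> O O1 O1' O2 O2' A B C _ _ IH _ IH1 d1 _ IH2 d2 o.
  move=> /In_cat[/IH//|/In_cat[]].
    by move=> /(discharge_sub d1)/IH1.
  by move=> /(discharge_sub d2)/IH2.
- by move=> O v i A _ _ IH _ _ o /IH.
- move=> O O1 O1' v i A B _ _ IH _ IH1 d _ _ _ _ o.
  by move=> /In_cat[/IH//|/(discharge_sub d)/IH1].
Qed.

Lemma entails_sentence U A : entails U A -> sentence A.
Proof. by move=> [O [/proof_sentence]]. Qed.

Lemma entails_mono U V A :
  (forall o, U o -> V o) -> entails U A -> entails V A.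
Proof. by move=> sUV [O [p HO]]; exists O, p => o /HO/sUV. Qed.

Lemma entails_assumption U A : sentence A -> U (A, false) -> entails U A.
Proof. by move=> sA UA; exists _, (Assumption S sA) => o [<-|[]]. Qed.

Lemma entails_axiom U A : axiom S A -> sentence A -> entails U A.
Proof. by move=> aA sA; exists _, (Axiom_leaf aA sA). Qed.

Lemma entails_rule1 U A B :
  rule1 S A B -> sentence B -> entails U A -> entails U B.
Proof. by move=> r sB [O [p HO]]; exists O, (Rule1 r sB p). Qed.

Lemma entails_rule2 U A B C :
  rule2 S A B C -> sentence C -> entails U A -> entails U B -> entails U C.
Proof.
move=> r sC [O1 [p1 H1]] [O2 [p2 H2]]; exists _, (Rule2 r sC p1 p2) => o.
by move=> /In_cat[/H1|/H2].
Qed.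

Lemma entails_And U A B : entails U A -> entails U B -> entails U (A :/\: B).
Proof.
move=> HA HB; apply: (entails_rule2 _ _ HA HB); first exact: and_intro.
by apply/sentence_And; split; apply: entails_sentence; [exact: HA|exact: HB].
Qed.

Lemma entails_All U v i A :
  (forall o, U o -> ~~ par_in i o.1) -> ~~ par_in i A ->
  entails U (subst v (Par i) A) -> entails U (All v A).
Proof.
move=> fU fA HA; have /(sentence_subst _ _ (closed_Par L i)) sA := entails_sentence HA.
case: HA => O [p HO]; unshelve eexists O, (All_intro sA p fA _) => //.
by move=> o /HO/fU.
Qed.

(** [Imp_elim] makes the assumptions of its right premise unsafe, a change that [derives] does not
    see. *)
Lemma derives_mp (Gamma : form L -> Prop) A B :
  derives S Gamma A -> derives S Gamma (A ~> B) -> derives S Gamma B.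
Proof.
move=> [O1 [p1 H1]] [O2 [p2 H2]].
have /sentence_Imp[_ sB] := proof_sentence p2.
exists _, (Imp_elim sB p1 p2) => o /In_cat[/H1//|].
by move=> /In_make_unsafe[o' /H2 ? ->].
Qed.

End Derivability.

(** * Reasoning under a hypothesis in the axiomatization *)

Section Hilbert.
Variables (L : signature) (Gamma : form L -> Prop).
Implicit Types (A B C D H : form L).

Local Notation "|- A" := (derives TJKdplus Gamma A) (at level 70, A at level 60).

Lemma derives_axiom A : axiom TJKdplus A -> sentence A -> |- A.
Proof. exact: entails_axiom. Qed.

Lemma derives_sentence A : |- A -> sentence A.
Proof. exact: entails_sentence. Qed.

Lemma derives_assumption A : sentence A -> Gamma A -> |- A.
Proof. exact: entails_assumption. Qed.

Lemma derives_And A B : |- A -> |- B -> |- A :/\: B.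
Proof. exact: entails_And. Qed.

Ltac sent_from := repeat match goal with
  | H : |- _ |- _ => move: (derives_sentence H); clear H end; move=> *; sent.

Lemma derives_trans A B C : |- A ~> B -> |- B ~> C -> |- A ~> C.
Proof.
move=> HAB HBC; apply: (derives_mp HBC); apply: (derives_mp HAB).
by apply: derives_axiom; [exact: ax_suffix | sent_from].
Qed.

Lemma derives_ax_trans A B C :
  |- A ~> B -> axiom TJKdplus (B ~> C) -> sentence C -> |- A ~> C.
Proof.
move=> HAB ax sC; apply: (derives_trans HAB); apply: derives_axiom ax _.
by sent_from.
Qed.

Lemma derives_ax_mp A B :
  |- A -> axiom TJKdplus (A ~> B) -> sentence B -> |- B.
Proof.
move=> HA ax sB; apply: (derives_mp HA); apply: derives_axiom ax _.
by sent_from.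
Qed.

Lemma derives_weak H A : sentence H -> |- A -> |- H ~> A.
Proof.
by move=> sH HA; apply: (derives_ax_mp HA); [exact: ax_weak | sent_from].
Qed.

Lemma derives_imp_And H A B : |- H ~> A -> |- H ~> B -> |- H ~> A :/\: B.
Proof.
move=> HA HB; apply: (derives_ax_mp (derives_And HA HB)).
  exact: ax_and_intro.
by sent_from.
Qed.

Lemma derives_Or_imp A B C : |- A ~> C -> |- B ~> C -> |- A :\/: B ~> C.
Proof.
move=> HA HB; apply: (derives_ax_mp (derives_And HA HB)).
  exact: ax_or_elim.
by sent_from.
Qed.

Lemma derives_id A : sentence A -> |- A ~> A.
Proof. by move=> sA; apply: derives_axiom; [exact: ax_id | sent]. Qed.

(* By weakening, [H] yields [A ~> H :/\: A]; no contraction is involved. *)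
Lemma derives_curry H A B : |- H :/\: A ~> B -> |- H ~> (A ~> B).
Proof.
move=> HB; have /sentence_Imp[/sentence_And[sH sA] sB] := derives_sentence HB.
have step : |- (A ~> H :/\: A) ~> (A ~> B).
  by apply: (derives_ax_mp HB); [exact: ax_prefix | sent].
apply: derives_trans step; apply: (@derives_ax_trans _ ((A ~> H) :/\: (A ~> A))).
- apply: derives_imp_And.
    by apply: derives_axiom; [exact: ax_weak | sent].
  exact/derives_weak/derives_id.
- exact: ax_and_intro.
- by sent.
Qed.

(** Distribution carries the context [H] into both disjuncts. *)
Lemma derives_cases H A B C :
  |- H ~> A :\/: B -> |- H :/\: A ~> C -> |- H :/\: B ~> C -> |- H ~> C.
Proof.
move=> HAB HA HB; apply: derives_trans (derives_Or_imp HA HB).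
apply: (@derives_ax_trans _ (H :/\: (A :\/: B))).
- apply: derives_imp_And HAB; apply: derives_id; by sent_from.
- exact: ax_distr.
- by sent_from.
Qed.

(** For each one-premise rule of the natural deduction system, the implication from premise to
    conclusion is an axiom. *)
Lemma derives_rule1_imp A B :
  rule1 NBQLCDr A B -> sentence A -> sentence B -> |- A ~> B.
Proof.
move=> r sA sB; apply: derives_axiom; last by sent.
case: r; constructor; by [].
Qed.

(** Each internal two-premise rule has an axiom leading from the conjunction of its premises to its
    conclusion; for [and_intro] that conjunction is the conclusion. *)
Lemma derives_rule2_imp H A B C : rule2 NBQLCDr A B C -> sentence C ->
  |- H ~> A -> |- H ~> B -> |- H ~> C.
Proof.
move=> r sC HA HB.
have HAB := derives_imp_And HA HB.
case: r sC {HA HB} HAB => // {}A {}B.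
- by move=> C0 _ sC HAB; apply: (derives_ax_trans HAB); first exact: ax_trans.
- by move=> C0 _ sC HAB; apply: (derives_ax_trans HAB); first exact: ax_and_intro.
- by move=> C0 _ sC HAB; apply: (derives_ax_trans HAB); first exact: ax_or_elim.
Qed.

Definition conj (S : seq (form L)) : form L := foldr (@And L) Top S.

Lemma conj_sentence S : (forall A, List.In A S -> sentence A) -> sentence (conj S).
Proof.
elim: S => //= A S IH sS; apply/sentence_And; split; first by apply: sS; left.
by apply: IH => B BS; apply: sS; right.
Qed.

Lemma conj_fresh i S :
  (forall A, List.In A S -> ~~ par_in i A) -> ~~ par_in i (conj S).
Proof.
elim: S => //= A S IH fS; rewrite negb_or fS ?IH //; last by left.
by move=> B BS; apply: fS; right.
Qed.

Lemma conj_elim S A : sentence (conj S) -> List.In A S -> |- conj S ~> A.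
Proof.
elim: S => //= B S IH /[dup] sBS /sentence_And[sB sS] [<-|AS].
  by apply: derives_axiom; [exact: ax_and_l | sent].
apply: derives_trans (IH sS AS).
by apply: derives_axiom; [exact: ax_and_r | sent].
Qed.

Lemma conj_sub S S' : sentence (conj S') ->
  (forall A, List.In A S -> List.In A S') -> |- conj S' ~> conj S.
Proof.
move=> sS'; elim: S => /= [_|A S IH sub].
  by apply: derives_axiom; [exact: ax_to_top | sent].
apply: derives_imp_And; first by apply: conj_elim => //; apply: sub; left.
by apply: IH => B BS; apply: sub; right.
Qed.

End Hilbert.

(** * From natural deduction to the axiomatization *)

Section FromNatural.
Variable L : signature.
Implicit Types (A B C : form L) (O : seq (occurrence L)) (G S : seq (form L)).

Local Notation "G |- A" := (derives TJKdplus (fun B => List.In B G) A)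
  (at level 70, A at level 60).

(* Only safe occurrences may go to the second part: these are the ones that may
   still be discharged further down in the proof. *)
Inductive split : seq (occurrence L) -> seq (form L) -> seq (form L) -> Prop :=
  | split_nil : split [::] [::] [::]
  | split_left o O G S : split O G S -> split (o :: O) (o.1 :: G) S
  | split_right A O G S : split O G S -> split ((A, false) :: O) G (A :: S).

Lemma split_cat O1 O2 G S : split (O1 ++ O2) G S ->
  exists G1 S1 G2 S2, [/\ split O1 G1 S1, split O2 G2 S2, G = G1 ++ G2
    & S = S1 ++ S2].
Proof.
elim: O1 G S => [|o O1 IH] G S /= sp.
  by exists [::], [::], G, S; split=> //; constructor.
inversion sp as [|o' O G' S' sp' |A O G' S' sp']; subst.
  have [G1 [S1 [G2 [S2 [sp1 sp2 -> ->]]]]] := IH _ _ sp'.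
  by exists (o.1 :: G1), S1, G2, S2; split=> //; constructor.
have [G1 [S1 [G2 [S2 [sp1 sp2 -> ->]]]]] := IH _ _ sp'.
by exists G1, (A :: S1), G2, S2; split=> //; constructor.
Qed.

(** Only [split_left] accepts an unsafe occurrence, and it forgets the flag, so the same [G] serves
    for [O]. *)
Lemma split_unsafe O G S : split (make_unsafe O) G S -> S = [::] /\ split O G [::].
Proof.
elim: O G S => [|o O IH] G S /= sp; inversion sp; subst.
  by split=> //; constructor.
by have [-> ?] := IH _ _ H3; split=> //; apply: (split_left o).
Qed.

(** Here the restriction on discharge is used: discharged leaves are safe, so they may be put back
    into the second part. There may be any number of them, whence an inclusion. *)
Lemma split_discharge A O O' G S :
  discharge NBQLCDr A O O' -> split O' G S ->
  exists S1, split O G S1 /\ forall B, List.In B S1 -> List.In B (A :: S).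
Proof.
move=> d; elim: d G S => {O O'} [|o O O' _ IH|u O O' safe _ IH] G S sp.
- by exists S; split=> //= B; auto.
- inversion sp as [|o' P G' S' sp'|B P G' S' sp']; subst.
    have [S1 [sp1 sub]] := IH _ _ sp'.
    by exists S1; split=> //; constructor.
  have [S1 [sp1 sub]] := IH _ _ sp'.
  exists (B :: S1); split; first by constructor.
  by move=> C /= [|/sub /=]; tauto.
- have [S1 [sp1 sub]] := IH _ _ sp.
  exists (A :: S1); split; first by rewrite safe //; constructor.
  by move=> C /= [|/sub /=]; tauto.
Qed.

Lemma split_In O G S B : split O G S -> List.In B G \/ List.In B S ->
  exists2 o, List.In o O & o.1 = B.
Proof.
elim=> {O G S} /= [|o O G S _ IH|A O G S _ IH]; first by case.
- case=> [[<-|BG]|BS]; first by exists o; auto.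
    by have [|o' ? ?] := IH; [auto|exists o'; auto].
  by have [|o' ? ?] := IH; [auto|exists o'; auto].
- case=> [BG|[<-|BS]]; last 1 first.
  + by have [|o' ? ?] := IH; [auto|exists o'; auto].
  + by have [|o' ? ?] := IH; [auto|exists o'; auto].
  by exists (A, false); auto.
Qed.

Lemma derives_strengthen G1 G2 S1 S2 A : sentence (conj S2) ->
  (forall B, List.In B G1 -> List.In B G2) ->
  (forall B, List.In B S1 -> List.In B S2) ->
  G1 |- conj S1 ~> A -> G2 |- conj S2 ~> A.
Proof.
move=> sS2 subG subS HA; apply: derives_trans (conj_sub _ sS2 subS) _.
by apply: entails_mono HA => o /subG.
Qed.

(** The common step of the discharging rules: the induction hypothesis is taken at the split that
    selects the discharged copies of [A], and the selection is then absorbed into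
    [conj (A :: S)]. *)
Lemma derives_discharged A O O' C G1 S1 G S :
  discharge NBQLCDr A O O' -> split O' G1 S1 ->
  (forall G S, split O G S -> G |- conj S ~> C) ->
  sentence A -> sentence (conj S) ->
  (forall B, List.In B G1 -> List.In B G) ->
  (forall B, List.In B S1 -> List.In B S) ->
  G |- conj S :/\: A ~> C.
Proof.
move=> d sp1 HC sA sS subG subS.
have [S0 [sp sub]] := split_discharge d sp1.
have sAS : sentence (conj (A :: S)) by apply/sentence_And.
apply: (@derives_trans _ _ _ (conj (A :: S))).
  apply: derives_imp_And; apply: derives_axiom; try sent.
    exact: ax_and_r.
  exact: ax_and_l.
apply: derives_strengthen (HC _ _ sp) => // B /sub /= [->|/subS]; by auto.
Qed.

(** The claim ranges over all splits because a subproof is needed at a larger selection than the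
    whole proof, namely one that includes the leaves about to be discharged. *)
Lemma natural_to_hilbert O A : proof NBQLCDr O A ->
  forall G S, split O G S -> G |- conj S ~> A.
Proof.
have conj_sent O' B G S : proof NBQLCDr O' B -> split O' G S ->
    sentence (conj S).
  move=> p sp; apply: conj_sentence => C CS.
  by have [|o oO <-] := split_In sp (B := C); [right|exact: proof_open_sentence p _ oO].
move=> p0; have := p0; elim: p0 => {O A}.
- move=> A sA p G S sp; have sS := conj_sent _ _ _ _ p sp.
  inversion sp as [|o O G' S' sp'|B O G' S' sp']; inversion sp'; subst.
    apply: derives_weak; first exact: conj_sentence.
    by apply: derives_assumption => //; left.
  by apply: conj_elim => //; left.
- move=> A aA sA p G S sp; apply: derives_weak; first exact: conj_sent p sp.
  by apply: derives_axiom => //; case: aA => //; constructor.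
- move=> O A B r sB p IH _ G S sp.
  apply: derives_trans (IH p _ _ sp) _.
  exact: derives_rule1_imp r (proof_sentence p) sB.
- move=> O1 O2 A B C r sC p1 IH1 p2 IH2 p G S sp.
  have sS := conj_sent _ _ _ _ p sp.
  have [G1 [S1 [G2 [S2 [sp1 sp2 eG eS]]]]] := split_cat sp.
  apply: derives_rule2_imp r sC _ _.
    apply: derives_strengthen (IH1 p1 _ _ sp1) => // D; rewrite ?eG ?eS In_cat; auto.
  apply: derives_strengthen (IH2 p2 _ _ sp2) => // D; rewrite ?eG ?eS In_cat; auto.
- move=> O1 O2 A B sB p1 IH1 p2 IH2 p G S sp.
  have sS := conj_sent _ _ _ _ p sp.
  have [G1 [S1 [G2 [S2 [sp1 sp2 eG eS]]]]] := split_cat sp.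
  have [eS2 sp2'] := split_unsafe sp2.
  have HA : G |- conj S ~> A.
    apply: derives_strengthen (IH1 p1 _ _ sp1) => // D; rewrite ?eG ?eS In_cat; auto.
  (* The empty conjunction is [Top], so the induction hypothesis for the right premise is
     [Top ~> (A ~> B)], and [Top] can be detached. *)
  apply: derives_trans HA _; apply: (@derives_mp _ _ _ Top).
    exact: derives_axiom (ax_top _ _) _.
  rewrite -[Top]/(conj [::]).
  by apply: derives_strengthen (IH2 p2 _ _ sp2') => // D; rewrite ?eG In_cat; auto.
- move=> O O' A B _ sAB p' IH d p G S sp.
  have sS := conj_sent _ _ _ _ p sp.
  apply/derives_curry/(derives_discharged d sp) => //; last by sent.
  exact: IH p'.
- move=> O O1 O1' O2 O2' A B C sC p IH p1 IH1 d1 p2 IH2 d2 p' G S sp.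
  have sS := conj_sent _ _ _ _ p' sp.
  have [G0 [S0 [G' [S' [sp0 sp' eG eS]]]]] := split_cat sp.
  have [G1 [S1 [G2 [S2 [sp1 sp2 eG' eS']]]]] := split_cat sp'.
  have /sentence_Or[sA sB] := proof_sentence p.
  apply: (derives_cases (A := A) (B := B)).
  + by apply: derives_strengthen (IH p _ _ sp0) => // D; rewrite ?eG ?eS In_cat; auto.
  + apply: (derives_discharged d1 sp1) => //; first exact: IH1 p1.
      by move=> D; rewrite eG eG' !In_cat; auto.
    by move=> D; rewrite eS eS' !In_cat; auto.
  + apply: (derives_discharged d2 sp2) => //; first exact: IH2 p2.
      by move=> D; rewrite eG eG' !In_cat; auto.
    by move=> D; rewrite eS eS' !In_cat; auto.
- move=> O v i A sA p IH fA fO p' G S sp.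
  have sS := conj_sent _ _ _ _ p sp.
  have fresh B : List.In B G \/ List.In B S -> ~~ par_in i B.
    by move=> BGS; have [o /fO ? <-] := split_In sp BGS.
  (* As [conj S] is a sentence, instantiating [v] leaves it alone; [ax_all_intro] then moves the
     quantifier to the consequent. *)
  have HA : G |- All v (conj S ~> A).
    apply: (@entails_All _ _ _ _ i) => [o oG||].
    + by apply: fresh; left.
    + by rewrite /= negb_or fA conj_fresh // => B BS; apply: fresh; right.
    + by rewrite /= subst_notin //; exact: IH p _ _ sp.
  apply: (derives_ax_mp HA); first exact: ax_all_intro.
  by apply/sentence_Imp.
- move=> O O1 O1' v i A B sB p IH p1 IH1 d notA fA fB fO p' G S sp.
  have sS := conj_sent _ _ _ _ p' sp.
  have [G0 [S0 [G1 [S1 [sp0 sp1 eG eS]]]]] := split_cat sp.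
  have sA := proof_sentence p.
  have fresh C : List.In C G1 \/ List.In C S1 -> ~~ par_in i C.
    move=> CGS; have [o oO1' <-] := split_In sp1 CGS.
    by apply: fO; [exact: discharge_sub d oO1' | exact: notA].
  have sS1 : sentence (conj S1).
    apply: conj_sentence => C CS; have sSS : forall C, List.In C S -> sentence C.
      by move=> D DS; have [|o oO <-] := split_In sp (B := D);
        [right|exact: proof_open_sentence p' _ oO].
    by apply: sSS; rewrite eS In_cat; right.
  have sA' : sentence (subst v (Par i) A) by apply/sentence_subst.
  (* The parameter may occur in the assumptions of the proof of [Ex v A], so one generalizes over
     the context of the other subproof alone. *)
  have HA : G1 |- All v (conj S1 :/\: A ~> B).
    apply: (@entails_All _ _ _ _ i) => [o oG||].
    + by apply: fresh; left.
    + by rewrite /= !negb_or fA fB conj_fresh // => C CS; apply: fresh; right.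
    + rewrite /= (subst_notin _ (sS1 v)) (subst_notin _ (sB v)).
      by apply: (derives_discharged d sp1) => //; exact: IH1 p1.
  have HE : G1 |- Ex v (conj S1 :/\: A) ~> B.
    by apply: (derives_ax_mp HA); [exact: ax_ex_elim | sent].
  have HS : G |- conj S ~> conj S1 :/\: Ex v A.
    apply: derives_imp_And.
      by apply: conj_sub => // C; rewrite eS In_cat; right.
    by apply: derives_strengthen (IH p _ _ sp0) => // D; rewrite ?eG ?eS In_cat; auto.
  (* [ax_ex_distr] brings the context under the existential quantifier. *)
  apply: (@derives_trans _ _ _ (Ex v (conj S1 :/\: A))).
    by apply: (derives_ax_trans HS); [exact: ax_ex_distr | sent].
  by apply: entails_mono HE => o oG1; rewrite eG In_cat; right.
Qed.

End FromNatural.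

(** * Natural deduction from safe assumptions only *)

Section Safe.
Variable L : signature.
Implicit Types (A B C D X Y Z : form L) (Gamma : form L -> Prop).

Definition safely Gamma A : Prop :=
  entails NBQLCDr (fun o => Gamma o.1 /\ o.2 = false) A.

Lemma safely_sentence Gamma A : safely Gamma A -> sentence A.
Proof. exact: entails_sentence. Qed.

Lemma safely_mono Gamma Delta A :
  (forall B, Gamma B -> Delta B) -> safely Gamma A -> safely Delta A.
Proof. by move=> sub; apply: entails_mono => o [/sub ? ?]. Qed.

Lemma safely_thm Gamma A : safely (fun _ => False) A -> safely Gamma A.
Proof. exact: safely_mono. Qed.

Lemma safely_assumption Gamma A : sentence A -> Gamma A -> safely Gamma A.
Proof. by move=> sA GA; apply: entails_assumption. Qed.

Definition add A Gamma : form L -> Prop := fun B => B = A \/ Gamma B.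

Lemma safely_hyp Gamma A : sentence A -> safely (add A Gamma) A.
Proof. by move=> sA; apply: safely_assumption => //; left. Qed.

Lemma safely_weaken Gamma A B : safely Gamma A -> safely (add B Gamma) A.
Proof. by apply: safely_mono => C; right. Qed.

Lemma safely_Top Gamma : safely Gamma Top.
Proof. exact: entails_axiom (ax_top _ _) _. Qed.

Lemma safely_rule1 Gamma A B :
  rule1 NBQLCDr A B -> sentence B -> safely Gamma A -> safely Gamma B.
Proof. exact: entails_rule1. Qed.

Lemma safely_And Gamma A B :
  safely Gamma A -> safely Gamma B -> safely Gamma (A :/\: B).
Proof. exact: entails_And. Qed.

Ltac sent_from := repeat match goal with
  | H : safely _ _ |- _ => move: (safely_sentence H); clear H end;
  move=> *; sent.

Lemma safely_fst Gamma A B : safely Gamma (A :/\: B) -> safely Gamma A.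
Proof.
by move=> HAB; apply: (safely_rule1 _ _ HAB); [exact: and_elim_l | sent_from].
Qed.

Lemma safely_snd Gamma A B : safely Gamma (A :/\: B) -> safely Gamma B.
Proof.
by move=> HAB; apply: (safely_rule1 _ _ HAB); [exact: and_elim_r | sent_from].
Qed.

Lemma safely_trans Gamma A B C :
  safely Gamma (A ~> B) -> safely Gamma (B ~> C) -> safely Gamma (A ~> C).
Proof.
move=> HAB HBC; apply: (entails_rule2 _ _ HAB HBC); first exact: internal_trans.
by sent_from.
Qed.

Lemma safely_imp_And Gamma A B C :
  safely Gamma (A ~> B) -> safely Gamma (A ~> C) -> safely Gamma (A ~> B :/\: C).
Proof.
move=> HAB HAC; apply: (entails_rule2 _ _ HAB HAC).
  exact: internal_and_intro.
by sent_from.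
Qed.

Lemma safely_Or_imp Gamma A B C :
  safely Gamma (A ~> C) -> safely Gamma (B ~> C) -> safely Gamma (A :\/: B ~> C).
Proof.
move=> HA HB; apply: (entails_rule2 _ _ HA HB); first exact: internal_or_elim.
by sent_from.
Qed.

(** A deduction theorem: with all open occurrences safe, those of [A] not covered by [Gamma] can be
    discharged. *)
Lemma safely_Imp Gamma A B :
  sentence A -> safely (add A Gamma) B -> safely Gamma (A ~> B).
Proof.
move=> sA [O [p HO]].
have sAB : sentence (A ~> B) by apply/sentence_Imp; split=> //; exact: proof_sentence p.
have [|O' [d HO']] := @discharge_exists _ NBQLCDr A
    (fun o => Gamma o.1 /\ o.2 = false) O.
  by move=> [B' u] /HO /= [[->|GB] ->]; auto.
by exists O', (Imp_intro erefl sAB p d).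
Qed.

Lemma safely_Imp_vacuous Gamma A B :
  sentence A -> safely Gamma B -> safely Gamma (A ~> B).
Proof. by move=> sA HB; apply: safely_Imp => //; apply: safely_weaken. Qed.

Lemma safely_Or Gamma A B C : safely Gamma (A :\/: B) ->
  safely (add A Gamma) C -> safely (add B Gamma) C -> safely Gamma C.
Proof.
move=> [O [p HO]] [O1 [p1 HO1]] [O2 [p2 HO2]].
pose U (o : occurrence L) := Gamma o.1 /\ o.2 = false.
have [|O1' [d1 HO1']] := @discharge_exists _ NBQLCDr A U O1.
  by move=> [D u] /HO1 /= [[->|GD] ->]; rewrite /U; auto.
have [|O2' [d2 HO2']] := @discharge_exists _ NBQLCDr B U O2.
  by move=> [D u] /HO2 /= [[->|GD] ->]; rewrite /U; auto.
exists _, (Or_elim (proof_sentence p1) p p1 d1 p2 d2) => o.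
by move=> /In_cat[/HO|/In_cat[/HO1'|/HO2']].
Qed.

Lemma safely_All Gamma v i A : (forall B, Gamma B -> ~~ par_in i B) ->
  ~~ par_in i A -> safely Gamma (subst v (Par i) A) -> safely Gamma (All v A).
Proof.
by move=> fG fA HA; apply: (entails_All _ fA HA) => o [/fG].
Qed.

Lemma safely_Ex Gamma v i A B : (forall C, Gamma C -> ~~ par_in i C) ->
  ~~ par_in i A -> ~~ par_in i B -> safely Gamma (Ex v A) ->
  safely (add (subst v (Par i) A) Gamma) B -> safely Gamma B.
Proof.
move=> fG fA fB [O [p HO]] [O1 [p1 HO1]].
(* [Ex_elim] must discharge every open copy of the instance, even one that [Gamma] allows, so [U]
   excludes it. Equality of formulas is decided classically, as the symbols come without decidable
   equality. *)
pose U (o : occurrence L) :=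
  o.1 <> subst v (Par i) A /\ Gamma o.1 /\ o.2 = false.
have [|O1' [d HO1']] := @discharge_exists _ NBQLCDr (subst v (Par i) A) U O1.
  move=> [C u] /HO1 [/= GC ->].
  have [->|neq] := classic (C = subst v (Par i) A); first by right.
  by case: GC => // GC; left.
unshelve eexists _, (Ex_elim (proof_sentence p1) p p1 d _ fA fB _).
- by move=> o /HO1'[].
- by move=> o /HO1 [[//|/fG]].
- by move=> o /In_cat[/HO|/HO1'[]].
Qed.

(** Each implicational axiom is a short derivation closed by [Imp_intro]; the internal rules take
    the place of modus ponens, and weakening is a vacuous discharge. *)
Lemma safely_axiom Gamma A : axiom TJKdplus A -> sentence A -> safely Gamma A.
Proof.
move=> aA sA; apply: safely_thm; case: aA sA => {A}.
- by move=> _; exact: safely_Top.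
- by move=> A _ sA; apply: safely_Imp; [|apply: safely_hyp]; sent.
- by move=> A _ sA; apply: safely_Imp_vacuous; [sent|exact: safely_Top].
- move=> A _ sA; apply: safely_Imp => //.
  by apply: (safely_rule1 (bot_elim _ _)); [sent|apply: safely_hyp].
- move=> A B C _ sA; apply: safely_Imp; first by sent.
  by apply: safely_imp_And; [apply: safely_fst | apply: safely_snd];
    apply: safely_hyp; sent.
- by move=> A B _ sA; apply: safely_Imp; [|apply: safely_fst; apply: safely_hyp]; sent.
- by move=> A B _ sA; apply: safely_Imp; [|apply: safely_snd; apply: safely_hyp]; sent.
- by move=> A B _ sA; apply: safely_Imp; [sent|];
    apply: (safely_rule1 (or_intro_l _ _ _)); [|apply: safely_hyp]; sent.
- by move=> A B _ sA; apply: safely_Imp; [sent|];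
    apply: (safely_rule1 (or_intro_r _ _ _)); [|apply: safely_hyp]; sent.
- move=> A B C _ sA; apply: safely_Imp; first by sent.
  by apply: safely_Or_imp; [apply: safely_fst | apply: safely_snd];
    apply: safely_hyp; sent.
- move=> A B C _ sA; apply: safely_Imp; first by sent.
  have HA : safely (add (A :/\: (B :\/: C)) (fun _ => False)) (A :/\: (B :\/: C)).
    by apply: safely_hyp; sent.
  apply: (safely_Or (safely_snd HA)).
    apply: (safely_rule1 (or_intro_l _ _ _)); first by sent.
    by apply: safely_And; [exact: safely_weaken (safely_fst HA)|apply: safely_hyp; sent].
  apply: (safely_rule1 (or_intro_r _ _ _)); first by sent.
  by apply: safely_And; [exact: safely_weaken (safely_fst HA)|apply: safely_hyp; sent].
- move=> v A B _ /sentence_Imp[sA sB]; apply: safely_Imp => //.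
  apply: (safely_rule1 (internal_all_intro _ _ _ _)) => //; exact: safely_hyp.
- move=> v A t _ ct /sentence_Imp[sA sB]; apply: safely_Imp => //.
  apply: (safely_rule1 (all_elim _ _ _ ct)) => //; exact: safely_hyp.
- move=> v A t _ ct /sentence_Imp[sA sB]; apply: safely_Imp => //.
  apply: (safely_rule1 (ex_intro _ _ _ ct)) => //; exact: safely_hyp.
- move=> v A B _ /sentence_Imp[sA sB]; apply: safely_Imp => //.
  apply: (safely_rule1 (internal_ex_elim _ _ _ _)) => //; exact: safely_hyp.
- move=> v A B _ /sentence_Imp[sA sB]; apply: safely_Imp => //.
  apply: (safely_rule1 (cd _ _ _ _)) => //; exact: safely_hyp.
- move=> v A B _ /sentence_Imp[sAB sEx]; apply: safely_Imp => //.
  (* The parameter must avoid the open hypothesis as well as the conclusion, hence both [A] and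
     [B]. *)
  have [i Hi] := form_fresh (A :/\: Ex v B).
  have /= := Hi i (leqnn i); rewrite negb_or => /andP[fA fB].
  have HAB := @safely_hyp (fun _ => False) _ sAB.
  have /sentence_And[sA sB] := sAB.
  have sBi : sentence (subst v (Par i) B) by apply/sentence_subst.
  apply: (safely_Ex (i := i) _ fB _ (safely_snd HAB)).
  + by move=> C [->|//]; rewrite /= negb_or fA.
  + by rewrite /= negb_or fA.
  apply: (safely_rule1 (ex_intro _ _ _ (closed_Par L i))) => //=.
  rewrite (subst_notin _ (sA v)).
  by apply: safely_And; [exact: safely_weaken (safely_fst HAB)|exact: safely_hyp].
- move=> A B C _ sA; apply: safely_Imp; first by sent.
  by apply: (@safely_trans _ _ B); [apply: safely_fst | apply: safely_snd];
    apply: safely_hyp; sent.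
- move=> A B C _ sA; apply: safely_Imp; first by sent.
  apply: safely_Imp; first by sent.
  by apply: (@safely_trans _ _ B); [apply: safely_weaken|]; apply: safely_hyp; sent.
- move=> A B C _ sA; apply: safely_Imp; first by sent.
  apply: safely_Imp; first by sent.
  by apply: (@safely_trans _ _ A); [|apply: safely_weaken]; apply: safely_hyp; sent.
- move=> A B _ sA; apply: safely_Imp; first by sent.
  by apply: safely_Imp_vacuous; [|apply: safely_hyp]; sent.
Qed.

(** * Derivability up to boxes *)

Definition box A : form L := Top ~> A.
Definition boxn n A : form L := iter n box A.

Lemma sentence_box A : sentence (box A) <-> sentence A.
Proof. by split=> sA; sent. Qed.

Lemma sentence_boxn n A : sentence (boxn n A) <-> sentence A.
Proof. by elim: n => //= n <-; exact: sentence_box. Qed.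

Lemma boxnD m n A : boxn (m + n) A = boxn m (boxn n A).
Proof. exact: iterD. Qed.

Lemma boxnSr n A : boxn n.+1 A = boxn n (box A).
Proof. exact: iterSr. Qed.

Lemma subst_boxn n v t A : subst v t (boxn n A) = boxn n (subst v t A).
Proof. by elim: n => //= n ->. Qed.

Lemma par_in_boxn n i A : par_in i (boxn n A) = par_in i A.
Proof. by elim: n => //= n ->. Qed.

(** A box is added by a vacuous discharge of [Top]; this brings derivations to a common number of
    boxes. *)
Lemma safely_pad Gamma m n A :
  m <= n -> safely Gamma (boxn m A) -> safely Gamma (boxn n A).
Proof.
move=> /subnK <-; rewrite boxnD; elim: (n - m) => //= k IH /IH.
exact: safely_Imp_vacuous.
Qed.

Lemma safely_boxn_imp Gamma n A B :
  safely (fun _ => False) (A ~> B) -> safely Gamma (boxn n A ~> boxn n B).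
Proof.
move=> HAB; apply: safely_thm; elim: n => //= n IH.
apply: safely_Imp; first by sent_from.
apply: safely_trans (safely_thm _ IH); apply: safely_hyp.
by sent_from.
Qed.

(** The outermost box turns the premise into an implication from [Top], so Internal Transitivity
    does the work of [Imp_elim]. *)
Lemma safely_boxnS_mp Gamma n A B : safely (fun _ => False) (A ~> B) ->
  safely Gamma (boxn n.+1 A) -> safely Gamma (boxn n.+1 B).
Proof. by move=> HAB HA; apply: safely_trans HA (safely_boxn_imp _ _ HAB). Qed.

Definition boxed Gamma A : Prop := exists n, safely Gamma (boxn n A).

Lemma boxed_safely Gamma A : safely Gamma A -> boxed Gamma A.
Proof. by exists 0. Qed.

Lemma boxed_sentence Gamma A : boxed Gamma A -> sentence A.
Proof. by case=> n /safely_sentence/sentence_boxn. Qed.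

Lemma boxed_boxn Gamma n A : boxed Gamma (boxn n A) -> boxed Gamma A.
Proof. by case=> m HA; exists (m + n); rewrite boxnD. Qed.

Lemma safely_box_mp Gamma A B :
  safely Gamma (box A) -> safely Gamma (box (A ~> B)) ->
  safely Gamma (box (box B)).
Proof.
move=> HA HAB; apply: (safely_trans HAB).
have sA := safely_sentence HA; have sAB := safely_sentence HAB.
apply: safely_Imp; first by sent.
apply: (safely_trans (safely_weaken _ HA)); apply: safely_hyp; sent.
Qed.

(* [box A] and [box (A ~> B)] safely yield [box (box B)], by suffixing the former
   with [B]. Under [n] further boxes, internalize this step and induct on [n]. *)
Lemma boxed_mp Gamma A B : boxed Gamma A -> boxed Gamma (A ~> B) -> boxed Gamma B.
Proof.
have base n : forall A B, safely Gamma (boxn n.+1 A) ->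
    safely Gamma (boxn n.+1 (A ~> B)) -> boxed Gamma B.
  elim: n => [|n IH] {}A {}B HA HAB.
    by exists 2; apply: safely_box_mp HAB.
  (* The new minor premise is [box (A ~> B)] and the new target [box (box B)]; the implication
     between them comes, under [n.+1] boxes, from [box A]. *)
  apply: (@boxed_boxn _ 2); apply: (IH (box (A ~> B))); last first.
    apply: safely_boxnS_mp; last by rewrite boxnSr in HA; exact: HA.
    have sA : sentence (A ~> B).
      by move: HAB => /safely_sentence/sentence_boxn.
    apply: safely_Imp; first by sent.
    apply: safely_Imp; first by sent.
    apply: (@safely_box_mp _ A); last by apply: safely_hyp; sent.
    by apply: safely_weaken; apply: safely_hyp; sent.
  by rewrite boxnSr in HAB.
(* [base] starts at one box, so both premises are padded to one more than the maximum. *)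
move=> [m HA] [n HAB]; apply: (base (maxn m n)).
  by apply: safely_pad HA; rewrite leqW // leq_maxl.
by apply: safely_pad HAB; rewrite leqW // leq_maxr.
Qed.

(** The pattern for rules without discharge: derive the curried implication safely, then detach with
    [boxed_mp]. *)
Lemma boxed_And Gamma A B :
  boxed Gamma A -> boxed Gamma B -> boxed Gamma (A :/\: B).
Proof.
move=> HA HB; have sA := boxed_sentence HA; have sB := boxed_sentence HB.
apply: (boxed_mp HB); apply: (boxed_mp HA); apply: boxed_safely.
do 2![apply: safely_Imp => //].
by apply: safely_And; [apply: safely_weaken|]; apply: safely_hyp.
Qed.

(** A Barcan-style commutation: [v] is not free in [Top], so Internal Universal Introduction passes
    the quantifier through one box at a time. *)
Lemma safely_All_boxn Gamma v n A : sentence (All v A) ->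
  safely Gamma (All v (boxn n A) ~> boxn n (All v A)).
Proof.
move=> sA; elim: n => [|n IH] /=.
  by apply: safely_Imp => //; apply: safely_hyp.
have sn : sentence (All v (boxn n A)).
  by case/sentence_Imp: (safely_sentence IH).
apply: safely_Imp; first by sent.
apply: safely_trans (safely_weaken _ IH).
apply: (safely_rule1 (internal_all_intro _ _ _ _)) => //.
by apply: safely_hyp; sent.
Qed.

Lemma boxed_All Gamma v i A : (forall B, Gamma B -> ~~ par_in i B) ->
  ~~ par_in i A -> boxed Gamma (subst v (Par i) A) -> boxed Gamma (All v A).
Proof.
move=> fG fA HA; have /(sentence_subst _ _ (closed_Par L i)) sA := boxed_sentence HA.
case: HA => n HA; apply: (@boxed_boxn _ n).
have HAll : safely Gamma (All v (boxn n A)).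
  by apply: (safely_All fG); rewrite ?par_in_boxn ?subst_boxn.
by apply: (boxed_mp (boxed_safely HAll)); apply/boxed_safely/safely_All_boxn.
Qed.

(** Allowing every large [m] lets two implications be given the same boxed consequent, as Internal
    Disjunction Elimination requires. *)
Lemma boxed_Imp Gamma A B : sentence A -> boxed (add A Gamma) B ->
  exists n, forall m, n <= m -> safely Gamma (A ~> boxn m B).
Proof.
move=> sA [n HB]; exists n => m le_nm.
by apply: safely_Imp => //; apply: safely_pad HB.
Qed.

Lemma boxed_Or Gamma A B C : boxed Gamma (A :\/: B) ->
  boxed (add A Gamma) C -> boxed (add B Gamma) C -> boxed Gamma C.
Proof.
move=> HAB; have /sentence_Or[sA sB] := boxed_sentence HAB.
move=> /(boxed_Imp sA)[m HA] /(boxed_Imp sB)[n HB].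
apply: (@boxed_boxn _ (maxn m n)); apply: (boxed_mp HAB); apply: boxed_safely.
by apply: safely_Or_imp; [apply: HA; apply: leq_maxl|apply: HB; apply: leq_maxr].
Qed.

Lemma boxed_Ex Gamma v i A B : (forall C, Gamma C -> ~~ par_in i C) ->
  ~~ par_in i A -> ~~ par_in i B -> boxed Gamma (Ex v A) ->
  boxed (add (subst v (Par i) A) Gamma) B -> boxed Gamma B.
Proof.
move=> fG fA fB HA HB; have sA := boxed_sentence HA; have sB := boxed_sentence HB.
have sAi : sentence (subst v (Par i) A) by apply/sentence_subst.
have [n {}HB] := boxed_Imp sAi HB.
have sBn : sentence (boxn n B) by apply/sentence_boxn.
apply: (@boxed_boxn _ n); apply: (boxed_mp HA); apply: boxed_safely.
apply: (safely_rule1 (internal_ex_elim _ _ _ _)) => //; first by sent.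
apply: (safely_All fG); first by rewrite /= negb_or fA par_in_boxn.
by rewrite /= (subst_notin _ (sBn v)); apply: HB.
Qed.

Lemma boxed_rule1 Gamma A B :
  rule1 TJKdplus A B -> sentence B -> boxed Gamma A -> boxed Gamma B.
Proof.
move=> r sB HA; have sA := boxed_sentence HA.
apply: (boxed_mp HA); apply: boxed_safely; apply: safely_Imp => //.
apply: safely_rule1 _ sB (safely_hyp _ sA).
by case: r => //; constructor.
Qed.

Lemma boxed_rule2 Gamma A B C : rule2 TJKdplus A B C -> sentence C ->
  boxed Gamma A -> boxed Gamma B -> boxed Gamma C.
Proof.
case=> // {A B C} [A B _|A B C D _ sC HAB HCD]; first exact: boxed_And.
have sAB := boxed_sentence HAB; have sCD := boxed_sentence HCD.
apply: (boxed_mp HCD); apply: (boxed_mp HAB); apply: boxed_safely.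
(* With both premises and [B ~> C] as safe hypotheses, affixing is Internal Transitivity used
   twice. *)
apply: safely_Imp => //; apply: safely_Imp => //; apply: safely_Imp; first by sent.
apply: (@safely_trans _ _ B); first by do 2!apply: safely_weaken; apply: safely_hyp.
apply: (@safely_trans _ _ C); first by apply: safely_hyp; sent.
by apply: safely_weaken; apply: safely_hyp.
Qed.

Lemma boxed_mono Gamma Delta A :
  (forall B, Gamma B -> Delta B) -> boxed Gamma A -> boxed Delta A.
Proof. by move=> sub [n HA]; exists n; apply: safely_mono HA. Qed.

(** * From the axiomatization to boxed derivability *)

Definition open_forms (O : seq (occurrence L)) A : Prop :=
  exists u, List.In (A, u) O.

Lemma open_forms_catl O1 O2 A : open_forms O1 A -> open_forms (O1 ++ O2) A.
Proof. by case=> u Au; exists u; apply/In_cat; left. Qed.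

Lemma open_forms_catr O1 O2 A : open_forms O2 A -> open_forms (O1 ++ O2) A.
Proof. by case=> u Au; exists u; apply/In_cat; right. Qed.

Lemma open_forms_discharge S A O O' B :
  discharge S A O O' -> open_forms O B -> add A (open_forms O') B.
Proof.
by move=> d [u /(discharge_in d)[|BO']]; [left | right; exists u].
Qed.

Lemma open_forms_unsafe O A : open_forms O A -> open_forms (make_unsafe O) A.
Proof.
case=> u; elim: O => //= o O IH [->|/IH[u' Au']]; first by exists true; left.
by exists u'; right.
Qed.

Lemma hilbert_to_boxed O A : proof TJKdplus O A -> boxed (open_forms O) A.
Proof.
elim=> {O A}.
- move=> A sA; apply/boxed_safely/safely_assumption => //; by exists false; left.
- by move=> A aA sA; apply/boxed_safely/safely_axiom.
- by move=> O A B r sB _; apply: boxed_rule1 r sB.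
- move=> O1 O2 A B C r sC _ IH1 _ IH2; apply: (boxed_rule2 r sC).
    by apply: boxed_mono IH1; apply: open_forms_catl.
  by apply: boxed_mono IH2; apply: open_forms_catr.
- move=> O1 O2 A B sB _ IH1 _ IH2; apply: (@boxed_mp _ A).
    by apply: boxed_mono IH1; apply: open_forms_catl.
  by apply: boxed_mono IH2 => C /open_forms_unsafe; apply: open_forms_catr.
(* [Imp_intro] would require [TJKdplus = NBQLCDr]. *)
- by [].
- move=> O O1 O1' O2 O2' A B C sC _ IH _ IH1 d1 _ IH2 d2.
  apply: (@boxed_Or _ A B).
  + by apply: boxed_mono IH; apply: open_forms_catl.
  + apply: boxed_mono IH1 => D /(open_forms_discharge d1)[->|DO]; first by left.
    by right; apply/open_forms_catr/open_forms_catl.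
  + apply: boxed_mono IH2 => D /(open_forms_discharge d2)[->|DO]; first by left.
    by right; apply/open_forms_catr/open_forms_catr.
- move=> O v i A sA _ IH fA fO; apply: (boxed_All _ fA IH).
  by move=> B [u /fO].
- move=> O O1 O1' v i A B sB _ IH _ IH1 d notA fA fB fO.
  (* [i] may occur in [O], so discharge under the assumption [Ex v A] itself. *)
  have HEx : boxed (open_forms (O ++ O1')) (Ex v A).
    by apply: boxed_mono IH; apply: open_forms_catl.
  have HB : boxed (add (Ex v A) (open_forms O1')) B.
    apply: (boxed_Ex _ fA fB).
    2: by apply/boxed_safely/safely_hyp; exact: boxed_sentence IH.
      move=> C [->|[u CO1']]; first by [].
      exact: fO (discharge_sub d CO1') (notA _ CO1').
    apply: boxed_mono IH1 => C /(open_forms_discharge d)[->|]; first by left.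
    by move=> ?; do 2!right.
  have [n HI] := boxed_Imp (boxed_sentence IH) HB.
  apply: (@boxed_boxn _ n); apply: (boxed_mp HEx); apply: boxed_safely.
  by apply: safely_mono (HI n (leqnn n)) => C; apply: open_forms_catr.
Qed.

Lemma derives_unbox Gamma n A :
  derives NBQLCDr Gamma (boxn n A) -> derives NBQLCDr Gamma A.
Proof.
elim: n => //= n IH HA; apply/IH/(derives_mp _ HA).
exact: entails_axiom (ax_top _ _) _.
Qed.

End Safe.

Theorem theorem6 (L : signature) (Gamma : form L -> Prop) (phi : form L)
  (hGamma : forall psi : form L, Gamma psi -> sentence psi)
  (hphi : sentence phi) :
  derives NBQLCDr Gamma phi <-> derives TJKdplus Gamma phi.
Proof.
split=> [] [O [p HO]].
  (* At the root nothing is left to discharge, so all occurrences go to the first part and the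
     translation yields [Top ~> phi]. *)
  have [G [sp GO]] : exists G, split O G [::] /\
      forall B, List.In B G -> exists2 o, List.In o O & o.1 = B.
    have [G sp] : exists G, split O G [::].
      elim: O {p HO} => [|o O [G sp]]; first by exists [::]; constructor.
      by exists (o.1 :: G); constructor.
    by exists G; split=> // B BG; apply: (split_In sp); left.
  have HT := natural_to_hilbert p sp.
  apply: (@derives_mp _ _ _ Top); first exact: entails_axiom (ax_top _ _) _.
  by apply: entails_mono HT => o /GO[o' /HO ? <-].
have [n HA] := hilbert_to_boxed p.
apply: (@derives_unbox _ _ n).
by apply: entails_mono HA => o [[u /HO]].
Qed.
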